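(* Let $(X,R)$ be a nontrivial wac tournament. Then $(X,R)$ has a prime quotient, which is unique up to isomorphism (any two prime quotients of $(X,R)$ are isomorphic topological tournaments). If the prime quotient is not an arc, then the prime quotient map is unique up to isomorphism: that is, if $h:(X,R)\to(Y,P)$ and $h_1:(X,R)\to(Y_1,P_1)$ are prime quotient maps and $(Y,P)$ is not an arc, then there exists an isomorphism $q:(Y,P)\to(Y_1,P_1)$ such that $q\circ h=h_1$.
   Context: All spaces are Hausdorff. A tournament on a nonempty set $X$ is a relation $R\subset X\times X$ with $R\cap R^{-1}=1_X=\{(x,x):x\in X\}$ and $R\cup R^{-1}=X\times X$. Its set of arcs is $R^\circ=R\setminus 1_X$. It is trivial if $X$ is a singleton and an arc if $X$ has exactly two points. $(X,R)$ is a compact topological tournament when $X$ is a compact space and $R$ is closed in $X\times X$. A 3-cycle is a triple of distinct points with $(x_1,x_2),(x_2,x_3),(x_3,x_1)\in R^\circ$. A point $x$ is a cycle point when every neighborhood of $x$ contains a 3-cycle which includes $x$. A wac (weakly arc cyclic) tournament is a compact topological tournament in which every non-isolated point is a cycle point. For compact topological tournaments, a quotient map $h:(X_2,R_2)\to(X_1,R_1)$ is a surjective continuous map $h:X_2\to X_1$ with $(h\times h)(R_2)\subset R_1$; it is an isomorphism when it is also injective. A nontrivial compact topological tournament $(Y,P)$ is prime when the only quotient maps $(Y,P)\to(Y_1,P_1)$ with $(Y_1,P_1)$ nontrivial are isomorphisms. A prime quotient map is a quotient map $(X,R)\to(Y,P)$ with $(Y,P)$ prime, and then $(Y,P)$ is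 called a prime quotient of $(X,R)$. *)

(* Defs.v *)
From mathcomp Require Import all_boot.
From mathcomp Require Import boolp classical_sets functions topology.

Set Implicit Arguments.
Unset Strict Implicit.
Unset Printing Implicit Defensive.

Local Open Scope classical_set_scope.

Section Tournament.
Context {X : Type}.
Implicit Type R : set (X * X).

Definition tournament R : Prop :=
  [/\ [set: X] !=set0,
      R `&` (R^-1)%relation = diagonal
    & R `|` (R^-1)%relation = [set: X * X]].

Definition arcs R : set (X * X) := R `\` diagonal.

Definition three_cycle R (x1 x2 x3 : X) : Prop :=
  [/\ x1 <> x2, x2 <> x3 & x3 <> x1] /\
  [/\ arcs R (x1, x2), arcs R (x2, x3) & arcs R (x3, x1)].

End Tournament.

Definition trivial_space (X : Type) : Prop := exists x : X, [set: X] = [set x].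

Definition two_points (X : Type) : Prop :=
  exists x y : X, x <> y /\ [set: X] = [set x; y].

Definition compact_tournament {X : topologicalType} (R : set (X * X)) : Prop :=
  [/\ hausdorff_space X, compact [set: X], tournament R & closed R].

Definition nontrivial_tournament {X : topologicalType} (R : set (X * X)) :
    Prop :=
  compact_tournament R /\ ~ trivial_space X.

Definition arc_tournament {X : topologicalType} (R : set (X * X)) : Prop :=
  compact_tournament R /\ two_points X.

Definition cycle_point {X : topologicalType} (R : set (X * X)) (x : X) : Prop :=
  forall U : set X, nbhs x U ->
  exists x1 x2 x3 : X,
    [/\ three_cycle R x1 x2 x3, [set x1; x2; x3] `<=` U
      & [set x1; x2; x3] x].

Definition wac {X : topologicalType} (R : set (X * X)) : Prop :=
  compact_tournament R /\
  forall x : X, ~ isolated [set: X] x -> cycle_point R x.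

Section Quotient.
Context {X2 X1 : topologicalType}.
Context (R2 : set (X2 * X2)) (R1 : set (X1 * X1)).

Definition quotient_map (h : X2 -> X1) : Prop :=
  [/\ compact_tournament R2, compact_tournament R1, range h = [set: X1],
      continuous h & [set (h u.1, h u.2) | u in R2] `<=` R1].

(* The inverse is not required to be continuous nor to preserve the relation:
   both follow, as the spaces are compact Hausdorff and the relations are
   tournaments. *)
Definition isomorphism (h : X2 -> X1) : Prop :=
  quotient_map h /\ injective h.

Definition isomorphic : Prop := exists h : X2 -> X1, isomorphism h.

End Quotient.

Definition prime_tournament {Y : topologicalType} (P : set (Y * Y)) : Prop :=
  nontrivial_tournament P /\
  forall (Y1 : topologicalType) (P1 : set (Y1 * Y1)) (h : Y -> Y1),
    nontrivial_tournament P1 -> quotient_map P P1 h -> isomorphism P P1 h.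

Definition prime_quotient_map {X Y : topologicalType} (R : set (X * X))
    (P : set (Y * Y)) (h : X -> Y) : Prop :=
  quotient_map R P h /\ prime_tournament P.

Definition prime_quotient {X Y : topologicalType} (R : set (X * X))
    (P : set (Y * Y)) : Prop :=
  exists h : X -> Y, prime_quotient_map R P h.

(* Main.v *)
Require Import Defs.
From mathcomp Require Import all_boot generic_quotient.
From mathcomp Require Import boolp classical_sets functions topology.

(** Quotient maps are governed by their kernels, which are congruences:
    equivalence relations whose classes are modules, sets whose points
    cannot be told apart from outside. The theorem translates into
    statements on maximal congruences among those that do not collapse
    everything: there is one, and if there are two different ones then each
    has exactly two classes.

    The wac hypothesis makes the topology of congruences trivial. If a
    module with at least two points contains a non-isolated point [x], then
    it contains a cycle through [x] ([module_cycle]): a cycle leaving the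
    module leaves it at both other vertices, and if all small ones did, then
    in the limit [x] would dominate and be dominated by another point of the
    module. A point near [x] is strictly between the other two vertices of
    such a cycle, hence in the module; so every module with at least two
    points is open ([module_open]). It is also closed, as its closure is a
    module in which a point outside the original one would be a source or a
    sink ([module_closed]). It follows that every congruence is a closed
    relation and has a compact Hausdorff quotient ([congruence_closed],
    [congruence_quotient]), and that by compactness the union of a chain of
    congruences which are not full is not full ([chain_not_full]). Zorn's
    lemma then gives a maximal congruence, and maximal congruences are
    exactly the kernels of prime quotient maps ([prime_kernel_maximal],
    [maximal_kernel_prime]).

    Uniqueness is combinatorial. Given two distinct maximal congruences,
    some class [A] of the first is split by the second and some class [B] of
    the second is split by the first. Maximality forces [A] and [B] to cover
    the space, and then [A] and its complement are the only classes of the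
    first congruence ([maximal_two_classes]). So two prime quotient maps
    have the same kernel, and differ by an isomorphism, or both quotients
    are arcs, and arcs are all isomorphic. *)

Local Open Scope classical_set_scope.

(** * Modules and congruences of a tournament *)

Section Combinatorics.
Context {X : Type} (R : set (X * X)).

(** The points of a module cannot be told apart from outside. The fibers of a
    homomorphism onto a tournament are modules. *)
Definition module (A : set X) : Prop :=
  forall z, ~ A z ->
    (forall a, A a -> R (a, z)) \/ (forall a, A a -> R (z, a)).

(** [E x] is the class of [x]; congruences are the kernels of homomorphisms onto
    tournaments. *)
Definition congruence (E : X -> set X) : Prop :=
  [/\ forall x, E x x, forall x y, E x y -> E y x,
      forall x y z, E x y -> E y z -> E x z & forall x, module (E x)].

(** For a congruence, this says that the quotient is nontrivial. *)
Definition not_full (E : X -> set X) : Prop := exists x y, ~ E x y.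

Definition maximal_congruence (E : X -> set X) : Prop :=
  [/\ congruence E, not_full E & forall F, congruence F -> not_full F ->
      (forall x, E x `<=` F x) -> forall x, F x `<=` E x].

Definition two_classes (E : X -> set X) : Prop :=
  exists x y, ~ E x y /\ forall z, E x z \/ E y z.

Hypothesis tR : tournament R.

Lemma dom_total x y : R (x, y) \/ R (y, x).
Proof.
have [_ _ RU] := tR.
by have : [set: X * X] (x, y) by []; rewrite -RU.
Qed.

Lemma dom_refl x : R (x, x).
Proof. by case: (dom_total x x). Qed.

Lemma dom_anti x y : R (x, y) -> R (y, x) -> x = y.
Proof.
move=> xy yx; have [_ RI _] := tR.
by have : (R `&` (R^-1)%relation) (x, y) by []; rewrite RI.
Qed.

Lemma arc_not_dom x y : arcs R (x, y) -> ~ R (y, x).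
Proof. by move=> [xy nxy] yx; apply: nxy; exact: dom_anti. Qed.

Lemma three_cycle_rot x y z : three_cycle R x y z -> three_cycle R y z x.
Proof. by move=> [[? ? ?] [? ? ?]]. Qed.

(** A point lying strictly between two points of a module tells them apart. *)
Lemma module_between {A a b z} : module A -> A a -> A b ->
  ~ R (z, a) -> ~ R (b, z) -> A z.
Proof.
move=> mA Aa Ab nza nbz; apply: contrapT => nAz.
by case: (mA _ nAz) => h; [apply: nbz|apply: nza]; exact: h.
Qed.

(** Arcs between two classes all point the same way: the endpoints can be moved
    one at a time, each inside the module which the other endpoint cannot split. *)
Lemma congruence_uniform E p q p' q' : congruence E -> ~ E p q ->
  E p p' -> E q q' -> R (p, q) -> R (p', q').
Proof.
move=> [r s t m] npq pp' qq' pq.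
have p'q : R (p', q).
  case: (m p q npq) => h; first exact: h.
  by case: npq; rewrite (dom_anti _ _ pq (h _ (r p))); exact: r.
have nqp' : ~ E q p' by move=> qp'; apply: npq; apply: t pp' _; exact: s.
case: (m q p' nqp') => h; last exact: h.
by case: nqp'; rewrite (dom_anti _ _ p'q (h _ (r q))); exact: r.
Qed.

(** A point outside the class of [x] in the union is outside its class in every
    member of the chain, and all these classes contain [x], so the arc between
    the point and [x] fixes the direction for all of them. *)
Lemma chain_congruence (C : set (X -> set X)) : C !=set0 ->
  (forall E, C E -> congruence E) ->
  (forall E F, C E -> C F ->
    (forall x, E x `<=` F x) \/ (forall x, F x `<=` E x)) ->
  congruence (fun x => [set y | exists2 E, C E & E x y]).
Proof.
move=> [E0 CE0] cC tot; split => [x|x y [E CE xy]|x y z [E CE xy] [F CF yz]|].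
- by exists E0 => //; have [r _ _ _] := cC _ CE0.
- by exists E => //; have [_ s _ _] := cC _ CE; exact: s.
- have [_ _ tE _] := cC _ CE; have [_ _ tF _] := cC _ CF.
  case: (tot E F CE CF) => h; [exists F|exists E] => //.
    by apply: tF yz; exact: h.
  by apply: tE xy _; exact: h.
- move=> x z nz.
  have nzE E : C E -> ~ E x z by move=> CE xz; apply: nz; exists E.
  have [xz|zx] := dom_total x z; [left|right] => a [E CE xa].
    have cE := cC _ CE; have [r _ _ _] := cE.
    by apply: (congruence_uniform E x z) => //; exact: nzE.
  have cE := cC _ CE; have [r s _ _] := cE.
  by apply: (congruence_uniform E z x) => // /s; exact: nzE.
Qed.

Definition saturation (E : X -> set X) (M : set X) : set X :=
  [set x | exists2 m, M m & E x m].

(** The smallest congruence that contains [E] and identifies the points of [M]: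
    the union of the classes meeting [M] is again a module, because each of
    these classes shares a point with [M]. *)
Lemma congruence_collapse E M : congruence E -> module M ->
  congruence (fun x y => E x y \/ (saturation E M x /\ saturation E M y)).
Proof.
move=> [r s t m] mM; pose S := saturation E M.
have SE x y : S x -> E x y -> S y.
  by move=> [w Mw xw] xy; exists w => //; apply: t xw; exact: s.
have mS : module S.
  move=> z nSz; have nMz : ~ M z by move=> Mz; apply: nSz; exists z.
  case: (mM _ nMz) => h; [left|right] => a [w Mw aw].
    have naz : ~ E a z by move=> az; apply: nSz; apply: SE az; exists w.
    case: (m _ _ naz) => h'; first exact: h'.
    by case: nMz; rewrite (dom_anti _ _ (h' _ aw) (h _ Mw)).
  have naz : ~ E a z by move=> az; apply: nSz; apply: SE az; exists w.
  case: (m _ _ naz) => h'; last exact: h'.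
  by case: nMz; rewrite (dom_anti _ _ (h _ Mw) (h' _ aw)).
split.
- by move=> x; left.
- by move=> x y [/s|[]]; [left|right].
- move=> x y z [xy|[Sx Sy]] [yz|[Sy' Sz]].
  + by left; exact: t yz.
  + by right; split => //; exact: SE (s _ _ xy).
  + by right; split => //; exact: SE yz.
  + by right.
- move=> x z nz; have [Sx|nSx] := pselect (S x).
    have nSz : ~ S z by move=> Sz; apply: nz; right.
    by case: (mS _ nSz) => h; [left|right] => a [xa|[_ Sa]]; apply: h => //;
      exact: SE xa.
  have nxz : ~ E x z by move=> xz; apply: nz; left.
  by case: (m _ _ nxz) => h; [left|right] => a [xa|[]//]; exact: h.
Qed.

(** Collapsing a module which is not inside a single class gives a strictly
    coarser congruence, which by maximality is full. *)
Lemma maximal_saturation E M x y z : maximal_congruence E -> module M ->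
  M x -> M y -> ~ E x y -> saturation E M z.
Proof.
move=> [cE _ mxE] mM Mx My nxy; have [r s t m] := cE.
have cG := congruence_collapse E M cE mM.
have SM w : M w -> saturation E M w by move=> Mw; exists w.
apply: contrapT => nSz; apply: nxy; apply: mxE cG _ _ _ _ _ => //=.
- exists x, z; case=> [xz|[_ //]].
  by apply: nSz; exists x => //; exact: s.
- by move=> ? ? ?; left.
- by right; split; exact: SM.
Qed.

(** Two distinct maximal congruences both have arcs as quotients. Let [A] be
    the [E]-class of [x] and [B] an [F]-class split by [E]. Each is a module
    split by the other congruence, so every [F]-class meets [A] and every
    [E]-class meets [B]. If some [z] were outside both, then [z], a point of
    [A] and [B], a point of [A] in the [F]-class of [z] and a point of [B] in
    the [E]-class of [z] would form a square of classes whose arcs contradict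
    uniformity. So [A] and [B] cover, whence the complement of [A] is a module,
    and maximality leaves it only one class. *)
Lemma maximal_two_classes E F x y : maximal_congruence E ->
  maximal_congruence F -> E x y -> ~ F x y -> two_classes E.
Proof.
move=> mE mF xy nFxy; have [[r s t m] prE mxE] := mE.
have [[r' s' t' m'] prF mxF] := mF.
have [x' [y' [Fxy' nExy']]] : exists x' y', F x' y' /\ ~ E x' y'.
  apply: contrapT => nex; apply: nFxy; apply: mxF _ _ _ _ _ _ xy => // u v uv.
  by apply: contrapT => nuv; apply: nex; exists u, v.
have satA z : saturation F (E x) z.
  exact: (maximal_saturation _ _ x y) (m x) (r x) xy nFxy.
have satB z : saturation E (F x') z.
  exact: (maximal_saturation _ _ x' y') (m' x') (r' x') Fxy' nExy'.
have [p Bp xp] := satB x.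
have cover z : E x z \/ F x' z.
  apply: contrapT => /not_orP[nAz nBz].
  have [q Bq zq] := satB z; have [w Aw zw] := satA z.
  have npq : ~ E p q.
    by move=> pq; apply: nAz; apply: t xp (t _ _ _ pq _); exact: s.
  have npz : ~ F p z by move=> pz; apply: nBz; exact: t' pz.
  have Epw : E p w by apply: t Aw; exact: s.
  have Fpq : F p q by apply: t' Bq; exact: s'.
  (* [p, w] lie in [A] and [p, q] in [B], while [q, z] are [E]-related and
     [w, z] are [F]-related: both arcs between [q] and [w] are forced. *)
  have neqw : q <> w by move=> qw; apply: npq; rewrite qw.
  apply: neqw; case: (dom_total p q) => pq.
    apply: dom_anti.
      apply: (congruence_uniform F p z) => //.
      by apply: (congruence_uniform E p q) => //; exact: s.
    exact: (congruence_uniform E p q).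
  have nqp : ~ E q p by move=> /s.
  have nzp : ~ F z p by move=> /s'.
  apply: dom_anti.
    exact: (congruence_uniform E q p).
  apply: (congruence_uniform F z p) => //.
  by apply: (congruence_uniform E q p) => //; exact: s.
have [u Au nBu] : exists2 u, E x u & ~ F x' u.
  have [Bx|] := pselect (F x' x); last by exists x.
  by exists y => // By; apply: nFxy; apply: t' By; exact: s'.
(* The complement of [A] is contained in [B], so [u], which is outside [B],
   has the same direction to all of it; the other points of [A] copy [u]. *)
have mC : module (~` E x).
  move=> a /contrapT Aa; case: (m' _ _ nBu) => h; [left|right] => z nAz.
    have nzu : ~ E z u by move=> zu; apply: nAz; apply: t Au _; exact: s.
    apply: (congruence_uniform E z u) => //; first exact: t (s _ _ Au) Aa.
    by apply: h; case: (cover z).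
  have nuz : ~ E u z by move=> uz; apply: nAz; exact: t uz.
  apply: (congruence_uniform E u z) => //; first exact: t (s _ _ Au) Aa.
  by apply: h; case: (cover z).
have [v nAv] : exists v, ~ E x v.
  apply: contrapT => nex; case: prE => a [b]; apply.
  have Ex c : E x c by apply: contrapT => ?; apply: nex; exists c.
  by apply: t (Ex b); exact: s.
exists x, v; split => // z; have [|nAz] := pselect (E x z); first by left.
right; apply: contrapT => nvz.
by have [w nAw] := maximal_saturation E _ v z x mE mC nAv nAz nvz.
Qed.

End Combinatorics.

(** * Congruences of a wac tournament *)

Section Wac.
Context {X : topologicalType} (R : set (X * X)).
Hypothesis wacR : wac R.

Let ctR : compact_tournament R.
Proof. by case: wacR. Qed.
Let tR : tournament R.
Proof. by case: ctR. Qed.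
Let clR : closed R.
Proof. by case: ctR. Qed.

Lemma near_not_dom (x z : X) : ~ R (x, z) ->
  exists U V, [/\ nbhs x U, nbhs z V & forall u v, U u -> V v -> ~ R (u, v)].
Proof.
move=> nR; have : nbhs (x, z) (~` R).
  by apply: open_nbhs_nbhs; split => //; exact: closed_openC.
case=> [[U V] /= [nU nV] sub]; exists U, V; split => // u v Uu Vv.
exact: sub (u, v) (conj Uu Vv).
Qed.

Lemma near_not_doml (x z : X) : ~ R (x, z) -> nbhs x [set u | ~ R (u, z)].
Proof.
move=> /near_not_dom[U [V [nU nV UV]]]; apply: filterS nU => u Uu.
by apply: UV => //; exact: nbhs_singleton.
Qed.

Lemma near_not_domr (x z : X) : ~ R (x, z) -> nbhs z [set v | ~ R (x, v)].
Proof.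
move=> /near_not_dom[U [V [nU nV UV]]]; apply: filterS nV => v Vv.
by apply: UV => //; exact: nbhs_singleton.
Qed.

Lemma closure_doml (A : set X) (z : X) : (forall a, A a -> R (a, z)) ->
  forall a, closure A a -> R (a, z).
Proof.
move=> h a cAa; apply: contrapT => /near_not_doml /cAa[b [Ab]]; apply.
exact: h.
Qed.

Lemma closure_domr (A : set X) (z : X) : (forall a, A a -> R (z, a)) ->
  forall a, closure A a -> R (z, a).
Proof.
move=> h a cAa; apply: contrapT => /near_not_domr /cAa[b [Ab]]; apply.
exact: h.
Qed.

Lemma wac_cycle (x : X) (U : set X) : ~ nbhs x [set x] -> nbhs x U ->
  exists c d, [/\ U c, U d, ~ R (c, x), ~ R (d, c) & ~ R (x, d)].
Proof.
move=> nx nU; have nix : ~ isolated [set: X] x.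
  by move=> [_ [V nV]]; rewrite setIT => VE; apply: nx; rewrite -VE.
have [x1 [x2 [x3 [C sub xC]]]] := (wacR.2 x nix) U nU.
have [c [d [Uc Ud [_ [xc cd dx]]]]] :
    exists c d, [/\ U c, U d & three_cycle R x c d].
  have U1 : U x1 by apply: sub; left; left.
  have U2 : U x2 by apply: sub; left; right.
  have U3 : U x3 by apply: sub; right.
  case: xC => [[]|] /= ->.
  - by exists x2, x3.
  - by exists x3, x1; split => //; exact: three_cycle_rot.
  - by exists x1, x2; split => //; do 2! apply: three_cycle_rot.
by exists c, d; split => //; exact: arc_not_dom.
Qed.

(** A cycle through [x] which leaves the
    module [A] leaves it at both other vertices. If all small cycles did so,
    their vertices would be, with respect to [a], on both sides; letting the
    cycles shrink to [x] would give both arcs between [a] and [x]. *)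
Lemma module_cycle (A : set X) (x a : X) : module R A -> A x -> A a -> x <> a ->
  ~ nbhs x [set x] ->
  exists c d, [/\ A c, A d, ~ R (c, x), ~ R (d, c) & ~ R (x, d)].
Proof.
move=> mA Ax Aa xa nx; apply: contrapT => nex.
have [axV xaV] : R (a, x) /\ R (x, a).
  have cyc U : nbhs x U -> exists c d, [/\ U c, U d, R (a, c) & R (d, a)].
    move=> nU; have [c [d [Uc Ud cx dc xd]]] := wac_cycle x U nx nU.
    exists c, d; split => //.
      have nAc : ~ A c.
        move=> Ac; apply: nex; exists c, d; split => //.
        exact: (module_between R mA Ac Ax).
      case: (mA _ nAc) => h; first exact: h.
      by case: cx; exact: h.
    have nAd : ~ A d.
      move=> Ad; apply: nex; exists c, d; split => //.
      exact: (module_between R mA Ax Ad).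
    case: (mA _ nAd) => h; last exact: h.
    by case: xd; exact: h.
  split; apply: contrapT.
    by move=> /near_not_domr /cyc[c [d [] ]].
  by move=> /near_not_doml /cyc[c [d [] ]].
by apply: xa; exact: dom_anti tR _ _ _ _.
Qed.

(** A cycle inside [A] through a non-isolated point [x] puts [x], and then by
    closedness of [R] all points near [x], strictly between two points of [A]. *)
Lemma module_open (A : set X) (a b : X) :
  module R A -> A a -> A b -> a <> b -> open A.
Proof.
move=> mA Aa Ab ab; rewrite openE => x Ax.
have [/(filterS _)|nx] := pselect (nbhs x [set x]).
  by apply => y ->.
have [y Ay xy] : exists2 y, A y & x <> y.
  have [xa|] := pselect (x = a); last by exists a.
  by exists b => //; rewrite xa.
have [c [d [Ac Ad cx dc xd]]] := module_cycle A x y mA Ax Ay xy nx.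
rewrite /interior; near=> z.
apply: (module_between R mA Ad Ac); near: z.
  exact: near_not_doml.
exact: near_not_domr.
Unshelve. all: by end_near. Qed.

(** A direction uniform on a set is inherited by its closure, as [R] is closed. *)
Lemma closure_module (A : set X) : module R A -> module R (closure A).
Proof.
move=> mA z nz; have nAz : ~ A z by move=> /subset_closure.
case: (mA _ nAz) => h; [left; exact: closure_doml|right; exact: closure_domr].
Qed.

(** A limit [b] of [A] outside [A] would be a source or a sink of the module
    [closure A], which however contains a cycle through [b]. *)
Lemma module_closed (A : set X) : module R A -> closed A.
Proof.
move=> mA b cb; apply: contrapT => nAb.
have nb : ~ nbhs b [set b] by move=> /cb[x [Ax xb]]; apply: nAb; rewrite -xb.
have [a [Aa _]] := cb _ filterT.
have ba : b <> a by move=> ba; apply: nAb; rewrite ba.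
have [c [d [Ac Ad cb' _ bd]]] := module_cycle (closure A) b a
  (closure_module A mA) cb (subset_closure Aa) ba nb.
case: (mA _ nAb) => h.
  by apply: cb'; exact: closure_doml h _ Ac.
by apply: bd; exact: closure_domr h _ Ad.
Qed.

(** The difficult case is a pair of singleton classes [a], [b], where pairs of
    related points [u], [v] might accumulate. With an arc from [a] to [b] and a
    cycle through [a] close to [a], the successor [c] of [a] ends up strictly
    between [u] and [v], hence in their class; but the class of [c] is closed
    and stays away from [a]. *)
Lemma congruence_closed (E : X -> set X) (x y : X) : congruence R E -> ~ E x y ->
  exists U V, [/\ nbhs x U, nbhs y V & forall u v, U u -> V v -> ~ E u v].
Proof.
move=> [r s t m].
have clop z z' : E z z' -> z <> z' -> nbhs z (E z).
  move=> zz' nzz'; apply: open_nbhs_nbhs; split => //.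
  exact: (module_open (E z) z z').
have nC z w : ~ E z w -> nbhs w (~` E z).
  move=> nzw; apply: open_nbhs_nbhs; split => //.
  by apply: closed_openC; exact: module_closed.
have main a b : R (a, b) -> ~ E a b -> exists U V,
    [/\ nbhs a U, nbhs b V & forall u v, U u -> V v -> ~ E u v].
  move=> ab nab.
  have nE : a <> b by move=> ab'; apply: nab; rewrite ab'.
  have [[a' aa' naa']|] := pselect (exists2 a', E a a' & a <> a').
    exists (E a), (~` E a); split; [exact: clop aa' naa'|exact: nC|].
    by move=> u v au nav uv; apply: nav; exact: t uv.
  move=> /forall2NP ta; have [na|na] := pselect (nbhs a [set a]).
    exists [set a], (~` E a); split => //; first exact: nC.
    by move=> u v ->.
  have nba : ~ R (b, a) by move=> /(dom_anti R tR _ _ ab)/nE.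
  have [c [d [nbc _ nca _ _]]] := wac_cycle a _ na (near_not_domr _ _ nba).
  have nac : ~ E c a.
    move=> /s ac; case: (ta c) => // nac; apply: nca.
    by rewrite (contrapT nac); exact: dom_refl.
  exists (~` E c `&` [set u | ~ R (c, u)]), [set v | ~ R (v, c)]; split.
  - by apply: filterI; [exact: nC|exact: near_not_domr].
  - exact: near_not_doml.
  - move=> u v [ncu cu] vc uv; apply: ncu; apply: s.
    exact: (module_between R (m u) (r u) uv).
move=> nxy; case: (dom_total R tR x y) => xy; first exact: main.
have nyx : ~ E y x by move=> /s.
have [U [V [nU nV UV]]] := main y x xy nyx.
by exists V, U; split => // u v Vu Uv /s; exact: UV.
Qed.

(** Nontrivial classes are open, and the other ones add nothing to [U]. *)
Lemma saturation_open (E : X -> set X) (U : set X) : congruence R E -> open U ->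
  open (saturation E U).
Proof.
move=> [r s t m] oU; rewrite openE => x [u Uu xu]; rewrite /interior.
have [->|nxu] := pselect (x = u).
  apply: filterS (open_nbhs_nbhs (conj oU Uu)) => v Uv; by exists v.
apply: filterS (open_nbhs_nbhs (conj (module_open (E x) x u _ _ _ _) _)) => //.
by move=> v xv; exists u => //; apply: t xu; exact: s.
Qed.

(** Compactness: if the union were full, the classes of [p] in the members of the
    chain relating [p] to [q] would be an increasing open cover, so one of them
    would be everything. *)
Lemma chain_not_full (C : set (X -> set X)) (p q : X) : p <> q ->
  (forall E, C E -> congruence R E /\ not_full E) ->
  (forall E F, C E -> C F ->
    (forall x, E x `<=` F x) \/ (forall x, F x `<=` E x)) ->
  not_full (fun x => [set y | exists2 E, C E & E x y]).
Proof.
move=> pq cC tot; apply: contrapT => nprop.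
have full x y : exists2 E, C E & E x y.
  by apply: contrapT => nxy; apply: nprop; exists x, y.
have [E0 CE0 E0pq] := full p q.
pose D : set (X -> set X) := [set E | C E /\ E p q].
pose F := filter_from D (fun E => ~` E p : set X).
have PF : ProperFilter F.
  apply: filter_from_proper.
    apply: filter_from_filter; first by exists E0.
    move=> E G [CE Epq] [CG Gpq]; case: (tot E G CE CG) => h.
      by exists G => // z nz; split => // Ez; apply: nz; exact: h.
    by exists E => // z nz; split => // Ez; apply: nz; exact: h.
  move=> E [CE _]; have [[r s t _] [x [y nxy]]] := cC _ CE.
  apply: contrapT => nex; apply: nxy.
  have Ep z : E p z by apply: contrapT => ?; apply: nex; exists z.
  by apply: t (Ep y); exact: s.
have [_ cX _ _] := ctR.
have [y [_ cy]] := cX F PF filterT.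
have [E CE py] := full p y.
have [G [CG Gpq] Gpy] : exists2 G, D G & G p y.
  by case: (tot E E0 CE CE0) => h; [exists E0|exists E] => //;
    do ?split => //; exact: h.
have FG : F (~` G p) by exists G.
have [[r _ _ m] _] := cC _ CG.
have nG : nbhs y (G p).
  apply: open_nbhs_nbhs; split => //; exact: (module_open (G p) p q).
by have [z []] := cy _ _ FG nG.
Qed.

(** Zorn on graphs of relations, where the diagonal is added to every graph so
    that the union of the empty chain is a congruence as well. *)
Lemma maximal_congruence_exists : ~ trivial_space X ->
  exists E, maximal_congruence R E.
Proof.
move=> ntX; have [[p _] _ _] := tR.
have [q pq] : exists q, p <> q.
  apply: contrapT => nex; apply: ntX; exists p; apply/seteqP; split => // q _.
  by apply: contrapT => nqp; apply: nex; exists q => pq; apply: nqp.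
pose EE (S : set (X * X)) (x : X) : set X := [set y | x = y \/ S (x, y)].
pose P := [set S | congruence R (EE S) /\ not_full (EE S)].
have sEE S T : S `<=` T -> forall x, EE S x `<=` EE T x.
  by move=> ST x y [|/ST]; [left|right].
have P0 : P set0.
  split; last by exists p, q => -[].
  split=> [x|x y [|//]|x y z [->|//]|] //; [by left|by move=> ->; left|].
  move=> x z nz; have [xz|zx] := dom_total R tR x z; [left|right] => a.
    by case=> // <-.
  by case=> // <-.
have [S [[cS pS] mxS]] : exists S, P S /\ forall T, S `<` T -> ~ P T.
  apply: Zorn_bigcup => F FP Ftot.
  pose C := EE @` (set0 |` F).
  have E_C : EE (\bigcup_(S in F) S) =
      (fun x => [set y | exists2 E, C E & E x y]).
    apply/funext => x; apply/seteqP; split => y /=.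
      case=> [<-|[S FS Sxy]]; last first.
        by exists (EE S); [exists S => //; right|right].
      by exists (EE set0); [exists set0 => //; left|left].
    move=> [_ [S [->|FS] <-] [|Sxy]] //; [by left|by left|].
    by right; exists S.
  have CP E : C E -> congruence R E /\ not_full E.
    by move=> [S SF <-]; case: SF => [->|/FP].
  have Ctot E G : C E -> C G ->
      (forall x, E x `<=` G x) \/ (forall x, G x `<=` E x).
    move=> [S SF <-] [T TF <-].
    case: SF TF => [->|FS] [->|FT].
    - by left; exact: sEE.
    - by left; apply: sEE; exact: sub0set.
    - by right; apply: sEE; exact: sub0set.
    - by case: (Ftot S T FS FT) => ST; [left|right]; exact: sEE.
  rewrite /P /= E_C; split.
    apply: (chain_congruence R tR) => //; last by move=> E /CP[].
    by exists (EE set0), set0 => //; left.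
  exact: (chain_not_full _ p q).
exists (EE S); split => // F cF pF SF x y xy; apply: contrapT => nSxy.
pose T : set (X * X) := [set u | F u.1 u.2].
have [r _ _ _] := cF.
have ET : EE T = F.
  apply/funext => u; apply/seteqP; split => v; last by right.
  by move=> [<-|].
apply: (mxS T); last by rewrite /P /= ET.
rewrite properEneq; split.
  apply/eqP => ST; apply: nSxy; rewrite ST; by right.
by move=> [u v] Suv; apply: SF; right.
Qed.

End Wac.

(** * Quotient maps and their kernels *)

Definition kernel {X Y : Type} (h : X -> Y) (x : X) : set X :=
  [set y | h x = h y].

Section QuotientMaps.
Context {X Y : topologicalType} (R : set (X * X)) (P : set (Y * Y)).
Context (h : X -> Y).
Hypothesis qh : quotient_map R P h.

Lemma quotient_surj y : exists x, h x = y.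
Proof.
have [_ _ rh _ _] := qh.
by have : [set: Y] y by []; rewrite -rh => -[x _ <-]; exists x.
Qed.

Lemma quotient_hom x y : R (x, y) -> P (h x, h y).
Proof. by have [_ _ _ _ hP] := qh => xy; apply: hP; exists (x, y). Qed.

Lemma kernel_congruence : congruence R (kernel h).
Proof.
have [[_ _ tR _] [_ _ tP _] _ _ _] := qh.
split => // [x y z|x z nxz]; first by rewrite /kernel /= => ->.
have [xz|zx] := dom_total R tR x z; [left|right] => a xa.
  case: (dom_total R tR a z) => // /quotient_hom za.
  case: nxz; apply: dom_anti tP _ _ _ _; first exact: quotient_hom.
  by rewrite (xa : h x = h a).
case: (dom_total R tR z a) => // /quotient_hom az.
case: nxz; apply: dom_anti tP _ _ _ _; last exact: quotient_hom.
by rewrite (xa : h x = h a).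
Qed.

Lemma kernel_not_full : ~ trivial_space Y -> not_full (kernel h).
Proof.
have [[_ _ [[x _] _ _] _] _ _ _ _] := qh.
move=> ntY; apply: contrapT => nex; apply: ntY; exists (h x).
apply/seteqP; split => // y _; have [z <-] := quotient_surj y.
by apply: contrapT => zx; apply: nex; exists z, x.
Qed.

Lemma quotient_nontrivial : not_full (kernel h) -> ~ trivial_space Y.
Proof.
move=> [x [y nxy]] [a aE]; apply: nxy; rewrite /kernel /=.
have e z : z = a by have : [set: Y] z by []; rewrite aE.
by rewrite (e (h x)) (e (h y)).
Qed.

Lemma quotient_two_points : two_classes (kernel h) -> two_points Y.
Proof.
move=> [x [y [nxy xy]]]; exists (h x), (h y); split => //.
apply/seteqP; split => // z _; have [w <-] := quotient_surj z.
by case: (xy w) => <-; [left|right].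
Qed.

Lemma quotient_closed_map (C : set X) : closed C -> closed (h @` C).
Proof.
have [[_ cX _ _] [hY _ _ _] _ ch _] := qh.
move=> clC; apply: compact_closed => //.
apply: continuous_compact; first exact: continuous_subspaceT.
exact: subclosed_compact clC cX _.
Qed.

Context {Z : topologicalType} (Q : set (Z * Z)) (g : X -> Z).
Hypothesis qg : quotient_map R Q g.

(** A quotient map is closed, hence topologically a quotient, and [P] is the
    image of [R] because [R] decides every pair. *)
Lemma quotient_factor : (forall x, kernel h x `<=` kernel g x) ->
  exists q : Y -> Z, quotient_map P Q q /\ q \o h = g.
Proof.
move=> hg; have [ctR ctP _ _ _] := qh; have [_ ctQ rg cg gQ] := qg.
have [s sK] : {s : Y -> X & forall y, h (s y) = y}.
  by exists (fun y => sval (cid (quotient_surj y))) => y; case: cid.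
have qE x : g (s (h x)) = g x by apply: hg; rewrite /kernel /= sK.
have [[_ _ tR _] [_ _ tP _] [_ _ tQ _]] := And3 ctR ctP ctQ.
exists (g \o s); split; last by apply/funext => x; exact: qE.
split => //.
- rewrite -rg; apply/seteqP; split => z [x _ <-]; first by exists (s x).
  by exists (h x) => //; exact: qE.
- apply/continuous_closedP => C clC.
  have -> : (g \o s) @^-1` C = h @` (g @^-1` C).
    apply/seteqP; split => [y Cy|_ [x Cx <-]]; first by exists (s y).
    by rewrite /preimage /= qE.
  by apply: quotient_closed_map; move/continuous_closedP: cg; exact.
- move=> _ [[y y'] /= yy' <-].
  case: (dom_total R tR (s y) (s y')) => ss'.
    by apply: gQ; exists (s y, s y').
  suff -> : y = y' by exact: dom_refl.
  apply: dom_anti tP _ _ yy' _; rewrite -(sK y) -(sK y').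
  exact: quotient_hom.
Qed.

End QuotientMaps.

(** * The quotient by a congruence *)

Section Existence.
Context {X : topologicalType} (R : set (X * X)).
Hypothesis wacR : wac R.
Context (E : X -> set X).
Hypothesis cE : congruence R E.
Local Open Scope quotient_scope.

(** Since saturations of open sets are open, the projection is an open map; this
    makes the quotient Hausdorff and its relation closed as soon as unrelated
    points can be separated by open sets without related points. *)
Lemma congruence_quotient : exists (Y : topologicalType) (P : set (Y * Y))
  (h : X -> Y), quotient_map R P h /\ kernel h = E.
Proof.
have [r s t _] := cE.
have [ctR _] := wacR; have [_ cX [[x0 _] _ _] clR] := ctR.
have tR : tournament R by case: ctR.
pose e : rel X := fun x y => `[< E x y >].
have e_refl : reflexive e by move=> x; apply/asboolP.
have e_sym : symmetric e by move=> x y; apply/asboolP/asboolP; exact: s.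
have e_trans : transitive e.
  by move=> y x z /asboolP xy /asboolP yz; apply/asboolP; exact: t yz.
pose eR := EquivRel e e_refl e_sym e_trans.
pose Y : topologicalType := quotient_topology {eq_quot eR}.
pose h : X -> Y := \pi_{eq_quot eR}.
have hE x y : h x = h y <-> E x y.
  split; first by move=> /eqquotP /asboolP.
  by move=> xy; apply/eqquotP/asboolP.
have surj (y : Y) : exists x, h x = y by exists (repr y); exact: reprK.
have ch : continuous h by exact: pi_continuous.
have oh (U : set X) : open U -> open (h @` U).
  move=> oU; change (open (h @^-1` (h @` U))).
  have -> : h @^-1` (h @` U) = saturation E U.
    apply/seteqP; split => x [u Uu ux]; exists u => //.
      by apply/hE.
    by apply/hE; exact: s.
  exact: (saturation_open R wacR).
have img z (W : set X) : nbhs z W -> nbhs (h z) (h @` W).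
  rewrite nbhsE => -[O [oO Oz] OW].
  apply: filterS (open_nbhs_nbhs (conj (oh O oO) _)); last by exists z.
  exact: image_subset.
have hY : hausdorff_space Y.
  move=> p q; have [x <-] := surj p; have [y <-] := surj q.
  move=> cl; apply: contrapT => /hE nxy.
  have [U [V [nU nV UV]]] := congruence_closed R wacR E x y cE nxy.
  have [_ [[u Uu <-] [v Vv /esym /hE uv]]] := cl _ _ (img _ _ nU) (img _ _ nV).
  exact: UV uv.
pose P : set (Y * Y) := [set (h u.1, h u.2) | u in R].
have cY : compact [set: Y].
  have -> : [set: Y] = h @` setT.
    by apply/seteqP; split => // y _; have [x <-] := surj y; exists x.
  by apply: continuous_compact => //; exact: continuous_subspaceT.
(* A pair outside [P] comes from unrelated [x], [x'] with no arc from [x] to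
   [x']; nearby points are still unrelated and without such an arc, and arcs
   between distinct classes are uniform. *)
have clP : closed P.
  move=> [y z]; have [x <-] := surj y; have [x' <-] := surj z => cl.
  apply: contrapT => nP.
  have nR : ~ R (x, x') by move=> xx'; apply: nP; exists (x, x').
  have nE : ~ E x x'.
    move=> /hE xx'; apply: nP; exists (x, x); first exact: dom_refl.
    by rewrite /= xx'.
  have [U [V [nU nV UV]]] := near_not_dom R wacR x x' nR.
  have [U' [V' [nU' nV' UV']]] := congruence_closed R wacR E x x' cE nE.
  have nUU := img _ _ (filterI nU nU'); have nVV := img _ _ (filterI nV nV').
  have /cl[[_ _] [[[a b] /= ab [<- <-]]]] :
      nbhs (h x, h x') ((h @` (U `&` U')) `*` (h @` (V `&` V'))).
    exists (h @` (U `&` U'), h @` (V `&` V')); last by move=> ?.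
    by split; [exact: nUU|exact: nVV].
  move=> [[u [Uu Uu'] /hE ua] [v [Vv Vv'] /hE vb]].
  apply: (UV u v) => //.
  apply: (congruence_uniform R tR E a b) => //; [|exact: s|exact: s].
  by move=> Eab; apply: (UV' u v) => //; apply: t (t _ _ _ Eab (s _ _ vb)).
have tP : tournament P.
  split; first by exists (h x0).
    apply/seteqP; split => -[y z] /=.
      move=> [[[a b] /= ab [<- <-]] [[b' a'] /= ba [bb aa]]].
      apply/hE; apply: contrapT => nab; apply: (nab).
      have aa' : E a a' by apply/hE; rewrite aa.
      have bb' : E b b' by apply/hE; rewrite bb.
      have ab' := congruence_uniform R tR E a b a' b' cE nab aa' bb' ab.
      apply: t aa' _; rewrite (dom_anti R tR _ _ ab' ba); exact: s.
    rewrite /diagonal /= => <-; have [x <-] := surj y.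
    by split; exists (x, x) => //=; exact: dom_refl.
  apply/seteqP; split => // -[y z] _.
  have [a <-] := surj y; have [b <-] := surj z.
  have [ab|ba] := dom_total R tR a b; first by left; exists (a, b).
  by right; exists (b, a).
exists Y, P, h; split.
  split => //.
  by apply/seteqP; split => // y _; have [x <-] := surj y; exists x.
by apply/funext => x; apply/seteqP; split => y /hE.
Qed.

End Existence.

(** * Prime quotients and maximal congruences *)

Lemma quotient_comp {X Y Z : topologicalType} (R : set (X * X))
    (P : set (Y * Y)) (Q : set (Z * Z)) (h : X -> Y) (g : Y -> Z) :
  quotient_map R P h -> quotient_map P Q g -> quotient_map R Q (g \o h).
Proof.
move=> qh qg; have [ctR _ _ ch _] := qh; have [_ ctQ _ cg _] := qg.
split => //.
- apply/seteqP; split => // z _; have [y <-] := quotient_surj _ _ _ qg z.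
  by have [x <-] := quotient_surj _ _ _ qh y; exists x.
- by move=> x; apply: continuous_comp; [exact: ch|exact: cg].
- move=> _ [[x y] xy <-].
  exact: (quotient_hom _ _ _ qg _ _ (quotient_hom _ _ _ qh _ _ xy)).
Qed.

(** A coarser congruence [F] is the kernel of some quotient map, which factors
    through [h] by a quotient map of the prime [P], so by an injection. *)
Lemma prime_kernel_maximal {X Y : topologicalType} (R : set (X * X))
    (P : set (Y * Y)) (h : X -> Y) :
  wac R -> prime_quotient_map R P h -> maximal_congruence R (kernel h).
Proof.
move=> wacR [qh [[ctP ntP] primeP]].
split => [||F cF nF hF x]; first exact: kernel_congruence qh.
  exact: kernel_not_full qh ntP.
have [Z [Q [g [qg gF]]]] := congruence_quotient R wacR F cF.
rewrite -gF in nF hF *.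
have [q [qq qhg]] := quotient_factor _ _ _ qh _ _ qg hF.
have ctQ : compact_tournament Q by case: qg.
have [_ injq] := primeP Z Q q (conj ctQ (quotient_nontrivial g nF)) qq.
move=> y; rewrite /kernel /= -qhg; exact: injq.
Qed.

(** A quotient map of [P] pulls back along [h] to a congruence above the kernel. *)
Lemma maximal_kernel_prime {X Y : topologicalType} (R : set (X * X))
    (P : set (Y * Y)) (h : X -> Y) :
  quotient_map R P h -> maximal_congruence R (kernel h) -> prime_tournament P.
Proof.
move=> qh [_ nh mxh]; split.
  by split; [case: qh|exact: quotient_nontrivial nh].
move=> Z Q g [_ ntQ] qg; split => // y y' gyy'.
have qgh := quotient_comp _ _ _ _ _ qh qg.
have [x hx] := quotient_surj _ _ _ qh y.
have [x' hx'] := quotient_surj _ _ _ qh y'.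
rewrite -hx -hx'; apply: mxh (kernel_congruence _ _ _ qgh) _ _ _ _ _.
- exact: kernel_not_full qgh ntQ.
- by move=> u v huv; rewrite /kernel /= huv.
- by rewrite /kernel /= hx hx'.
Qed.

Lemma two_points_ordered {Y : topologicalType} {P : set (Y * Y)} :
  arc_tournament P ->
  exists a b : Y, [/\ a <> b, P (a, b) & forall y, y = a \/ y = b].
Proof.
move=> [[_ _ tP _] [a [b [ab abE]]]].
have tot y : y = a \/ y = b by have : [set: Y] y by []; rewrite abE.
have [Pab|Pba] := dom_total P tP a b; first by exists a, b.
exists b, a; split => //; first by move=> ba; apply: ab.
by move=> y; case: (tot y); [right|left].
Qed.

(** Both arcs are listed with their source first; every subset of a two-point
    Hausdorff space is closed, so continuity is automatic. *)
Lemma arc_isomorphic {Y Z : topologicalType} {P : set (Y * Y)}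
    {Q : set (Z * Z)} :
  arc_tournament P -> arc_tournament Q -> isomorphic P Q.
Proof.
move=> aP aQ.
have [a [b [ab Pab totY]]] := two_points_ordered aP.
have [c [d [cd Qcd totZ]]] := two_points_ordered aQ.
have [[ctP _] [ctQ _]] := (aP, aQ).
have [[hY _ tP _] [_ _ tQ _]] := (ctP, ctQ).
pose q y := if pselect (y = a) then c else d.
have qa : q a = c by rewrite /q; case: pselect.
have qb : q b = d by rewrite /q; case: pselect => // ba; case: ab.
exists q; split; last first.
  move=> y y'; case: (totY y) => ->; case: (totY y') => -> //; rewrite qa qb //.
  by move=> /esym.
split => //.
- apply/seteqP; split => // z _.
  by case: (totZ z) => ->; [exists a|exists b].
- have cl1 (y : Y) : closed [set y].
    exact: (accessible_closed_set1 (hausdorff_accessible hY)).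
  apply/continuous_closedP => C _; set D := q @^-1` C.
  have -> : D = (D `&` [set a]) `|` (D `&` [set b]).
    apply/seteqP; split => y; last by case=> -[].
    by case: (totY y) => -> Dy; [left|right].
  have sub (y : Y) : closed (D `&` [set y]).
    have [Dy|nDy] := pselect (D y).
      suff -> : D `&` [set y] = [set y] by [].
      by apply/seteqP; split => [z []|z ->].
    suff -> : D `&` [set y] = set0 by exact: closed0.
    by apply/seteqP; split => // z [Dz zy]; apply: nDy; rewrite -zy.
  exact: closedU.
- move=> _ [[y y'] /= yy' <-]; move: yy'.
  case: (totY y) => ->; case: (totY y') => ->; rewrite ?qa ?qb => //.
  + by move=> _; exact: dom_refl.
  + by move=> /(dom_anti P tP _ _ Pab).
  + by move=> _; exact: dom_refl.
Qed.

(** The kernels are maximal congruences. Equal kernels give the factorization, and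
    distinct ones have two classes each. *)
Lemma prime_quotient_dichotomy {X Y Y1 : topologicalType} (R : set (X * X))
    (P : set (Y * Y)) (P1 : set (Y1 * Y1)) (h : X -> Y) (h1 : X -> Y1) :
  wac R -> prime_quotient_map R P h -> prime_quotient_map R P1 h1 ->
  (exists q : Y -> Y1, isomorphism P P1 q /\ q \o h = h1) \/
  (arc_tournament P /\ arc_tournament P1).
Proof.
move=> wacR ph ph1; have [[_ _ tR _] _] := wacR.
have mh := prime_kernel_maximal _ _ _ wacR ph.
have mh1 := prime_kernel_maximal _ _ _ wacR ph1.
have [[qh [[ctP _] _]] [qh1 [[ctP1 _] ]]] := (ph, ph1).
have [sub|] := pselect (forall x, kernel h x `<=` kernel h1 x).
  move=> _; left; have [q [qq qhE]] := quotient_factor _ _ _ qh _ _ qh1 sub.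
  exists q; split => //; split => // y y' qyy'.
  have [[_ _ mx] [ch1 nh1 _]] := (mh, mh1).
  have [x hx] := quotient_surj _ _ _ qh y.
  have [x' hx'] := quotient_surj _ _ _ qh y'.
  rewrite -hx -hx'; apply: (mx (kernel h1)) => //.
  by rewrite /kernel /= -qhE /= hx hx'.
move=> nsub _; right.
have [x [y [hxy nh1xy]]] : exists x y, kernel h x y /\ ~ kernel h1 x y.
  apply: contrapT => nex; apply: nsub => x y hxy.
  by apply: contrapT => nxy; apply: nex; exists x, y.
have two := maximal_two_classes R tR _ _ _ _ mh mh1 hxy nh1xy.
have [x' [y' [h1xy' nhxy']]] : exists x y, kernel h1 x y /\ ~ kernel h x y.
  apply: contrapT => nex; apply: nh1xy.
  have [[ch nh _] [_ _ mx1]] := (mh, mh1).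
  apply: (mx1 _ ch nh) => // u v uv.
  by apply: contrapT => nuv; apply: nex; exists u, v.
have two1 := maximal_two_classes R tR _ _ _ _ mh1 mh h1xy' nhxy'.
by split; split => //; [exact: quotient_two_points qh two
  |exact: quotient_two_points qh1 two1].
Qed.

Theorem theorem1p6 (X : topologicalType) (R : set (X * X))
    (wacR : wac R) (ntR : nontrivial_tournament R) :
  (exists (Y : topologicalType) (P : set (Y * Y)), prime_quotient R P) /\
  (forall (Y Y1 : topologicalType) (P : set (Y * Y)) (P1 : set (Y1 * Y1)),
     prime_quotient R P -> prime_quotient R P1 -> isomorphic P P1) /\
  (forall (Y Y1 : topologicalType) (P : set (Y * Y)) (P1 : set (Y1 * Y1))
     (h : X -> Y) (h1 : X -> Y1),
     prime_quotient_map R P h -> prime_quotient_map R P1 h1 ->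
     ~ arc_tournament P ->
     exists q : Y -> Y1, isomorphism P P1 q /\ q \o h = h1).
Proof.
split; [|split].
- have [E mE] := maximal_congruence_exists R wacR ntR.2.
  have [cE _ _] := mE.
  have [Y [P [h [qh hE]]]] := congruence_quotient R wacR E cE.
  exists Y, P, h; split => //; apply: maximal_kernel_prime qh _.
  by rewrite hE.
- move=> Y Y1 P P1 [h ph] [h1 ph1].
  case: (prime_quotient_dichotomy _ _ _ _ _ wacR ph ph1).
    by move=> [q [iq _]]; exists q.
  by case; exact: arc_isomorphic.
- move=> Y Y1 P P1 h h1 ph ph1 nP.
  by case: (prime_quotient_dichotomy _ _ _ _ _ wacR ph ph1) => // -[].
Qed.
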